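(* Let $s \geq 2$ be an integer and let $\mathcal{P}$ be a finite non-empty set of primes such that $\gcd(s, p-1) \neq 1$ for every $p \in \mathcal{P}$; let $P = \#\mathcal{P}$. For each $p \in \mathcal{P}$ fix a non-principal Dirichlet character $\chi_p$ modulo $p$ such that $\chi_p(n^s) = \chi_0(n)$ for all integers $n$, where $\chi_0$ is the principal character modulo $p$ (such a character exists since $\gcd(s,p-1)\ge 2$). Let $w$ be a nonnegative function on the integers with $\sum_n w(n) < \infty$, and suppose moreover that $w(0) = 0$ and $w(n) = 0$ for all $n \geq e^{P}$. Define $S(\mathcal{A}) = \sum_{n=1}^{\infty} w(n^s)$. Then $$S(\mathcal{A}) \ll P^{-1} \sum_{n=1}^{\infty} w(n) + P^{-2} \sum_{\substack{p, q \in \mathcal{P}\\ p \neq q}} \left| \sum_{n=1}^{\infty} w(n)\, \chi_p(n)\, \overline{\chi_q(n)} \right|,$$ where the implied constant is independent of $w$ and $\mathcal{P}$. *)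

(* Defs.v *)
From HB Require Import structures.
From mathcomp Require Import all_boot all_order all_algebra finmap.
From mathcomp Require Import complex.
From mathcomp Require Import all_classical all_reals all_analysis.

Set Implicit Arguments.
Unset Strict Implicit.
Unset Printing Implicit Defensive.

Import Order.TTheory GRing.Theory Num.Theory.
Import numFieldNormedType.Exports.

Local Open Scope ring_scope.
Local Open Scope classical_set_scope.

Section DirichletCharacters.
Variable R : realType.

(* A character of (Z/qZ)^* extended by zero to all integers. Complete
   multiplicativity and the support condition at n = 1 force chi 1 = 1. *)
Definition dirichlet_character (q : nat) (chi : int -> R[i]) : Prop :=
  [/\ forall m n : int, chi (m * n) = chi m * chi n,
      forall m n : int, (m = n %[mod q])%Z -> chi m = chi n
    & forall n : int, (chi n != 0) = coprimez n q].

Definition principal_character (q : nat) (n : int) : R[i] :=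
  (coprimez n q)%:R.

End DirichletCharacters.

(* R and R[i] share this definition. The limit defaults to a junk value for a
   divergent series; for the eventually vanishing sequences considered here the
   partial sums stabilize. *)
Definition infinite_sum (K : numFieldType) (u : nat -> K) : K :=
  limn (fun N : nat => \sum_(1 <= n < N) u n).

Definition power_sifted_sum (R : realType) (s : nat) (w : int -> R) : R :=
  infinite_sum (fun n : nat => w (n%:Z ^+ s)).

Definition character_correlation (R : realType) (w : int -> R)
    (chi psi : int -> R[i]) : R[i] :=
  infinite_sum (fun n : nat => (w n%:Z)%:C%C * chi n%:Z * conjc (psi n%:Z)).

(* Main.v *)
(* Consider the second moment of [A n = \sum_(p in P) chi_p n] weighted by [w].
   At an s-th power [n = m ^ s], [A n] counts the [p] in [P] not dividing [m].
   If [w n != 0], then [m ^ 2 <= n < e ^ #|P|], so [m] has at most [4 #|P| / 5]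
   prime divisors and [A n >= #|P| / 5]: the second moment is at least
   [(#|P| / 5) ^ 2] times the sum of [w] over s-th powers. Expanding the square
   bounds it above by the diagonal, at most [#|P| * \sum_n w n], plus the
   off-diagonal correlations. *)
Require Import Defs.
From HB Require Import structures.
From mathcomp Require Import all_boot all_order all_algebra finmap.
From mathcomp Require Import complex.
From mathcomp Require Import all_classical all_reals all_analysis.
From mathcomp Require Import ring lra zify.

Set Implicit Arguments.
Unset Strict Implicit.
Unset Printing Implicit Defensive.

Import Order.TTheory GRing.Theory Num.Theory.
Import numFieldNormedType.Exports.

Local Open Scope ring_scope.
Local Open Scope classical_set_scope.

(** Partial sums are constant from [N.+1] on. The bound [N.+1] keeps the splitting point at least 1
    even when [N = 0]. *)
Lemma infinite_sum_finite (K : numFieldType) (u : nat -> K) (N : nat) :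
  (forall n, (N <= n)%N -> u n = 0) ->
  infinite_sum u = \sum_(1 <= n < N.+1) u n.
Proof.
move=> u0; apply: norm_lim_near_cst; exists N.+1 => // n /= ltNn.
rewrite (big_cat_nat _ ltNn) //= [X in _ + X]big_nat_cond.
rewrite [X in _ + X]big1 ?addr0 // => i /andP[/andP[/ltnW ltNi _] _].
exact: u0.
Qed.

Lemma expR1_lt3 (R : realType) : expR 1 < 3 :> R.
Proof.
(* The tangent bound [1 + x <= expR x] at [x = - 1 / 6] is sharp enough: it gives
   [e <= (6 / 5) ^ 6 = 2.985984]. *)
have h : 5 / 6 <= expR (- 6^-1) :> R by have := expR_ge1Dx (- 6^-1 : R); lra.
have -> : expR 1 = (expR (- 6^-1))^-1 ^+ 6 :> R.
  by rewrite -expRN opprK -expRM_natl mulfV.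
have e0 : 0 < expR (- 6^-1) :> R := expR_gt0 _.
have h' : (expR (- 6^-1))^-1 <= 6 / 5 :> R.
  by rewrite -[6 / 5]invf_div lef_pV2 // posrE; lra.
apply: le_lt_trans (_ : (6 / 5) ^+ 6 < 3); last by lra.
by rewrite lerXn2r // nnegrE ?invr_ge0 ?expR_ge0 //; lra.
Qed.

(** Divide out one prime at a time: by Euclid's lemma the other primes, being distinct from it,
    still divide the cofactor, and each prime is at least 2. *)
Lemma expn2_size_prime_divisors (r : seq nat) (m : nat) : uniq r ->
  {in r, forall p, prime p && (p %| m)%N} -> (0 < m)%N -> (2 ^ size r <= m)%N.
Proof.
elim: r m => [//|p r IHr] m /= /andP[pNr ur] hr m0.
have /andP[p_pr /dvdnP[k mE]] := hr p (mem_head _ _).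
rewrite mE in hr m0 *.
have k0 : (0 < k)%N by case: k m0 {mE hr}.
rewrite expnSr leq_mul ?prime_gt1 //; apply: IHr => // q qr.
have /andP[q_pr] : prime q && (q %| k * p)%N by apply: hr; rewrite inE qr orbT.
rewrite Euclid_dvdM // (dvdn_prime2 q_pr p_pr) q_pr => /orP[//|/eqP qp].
by rewrite qp in qr; rewrite qr in pNr.
Qed.

(** By multiplicativity [chi n ^+ s = chi (n ^+ s)], which is 0 or 1. *)
Lemma dirichlet_character_norm_le1 (R : realType) (p s : nat)
    (chi : int -> R[i]) (n : int) :
    dirichlet_character p chi -> (0 < s)%N ->
    chi (n ^+ s) = principal_character R p n ->
  `|chi n| <= 1.
Proof.
move=> [chiM _ _] s0 chis.
have chiX k : chi (n ^+ k.+1) = chi n ^+ k.+1.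
  by elim: k => [|k IH]; rewrite ?expr1 // exprS chiM IH -exprS.
rewrite -(prednK s0) chiX prednK // /principal_character in chis.
rewrite -(@expr_le1 _ s) // -normrX chis.
by case: coprimez; rewrite ?normr1 ?normr0.
Qed.

(** Since [m ^ s] is injective in [m], the powers below [N] are distinct indices of the right-hand
    sum; the powers from [N] on contribute 0. *)
Lemma ler_sum_expn (K : numDomainType) (s N : nat) (g : nat -> K) :
  (0 < s)%N -> (forall n, 0 <= g n) -> (forall n, (N <= n)%N -> g n = 0) ->
  \sum_(1 <= m < N) g (m ^ s)%N <= \sum_(1 <= n < N) g n.
Proof.
move=> s0 g0 gN.
rewrite (bigID (fun m => m ^ s < N)%N) /= [X in _ + X]big1 ?addr0; last first.
  by move=> m; rewrite -leqNgt => /gN.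
rewrite -big_filter -(big_map (expn^~ s) xpredT).
set r := map _ _.
rewrite [leRHS](bigID (mem r)) /= -[X in _ <= X + _]big_filter.
rewrite (perm_big [seq n <- index_iota 1 N | n \in r]) /=.
  by rewrite lerDl sumr_ge0.
apply: uniq_perm; rewrite ?filter_uniq ?iota_uniq //.
  rewrite map_inj_uniq ?filter_uniq ?iota_uniq // => x y /eqP.
  by rewrite eqn_exp2r // => /eqP.
move=> n; rewrite mem_filter; apply/idP/andP => [nr|[]//]; split=> //.
case/mapP: nr => m; rewrite mem_filter !mem_index_iota.
by case/andP=> mN /andP[m1 _] ->; rewrite expn_gt0 m1.
Qed.

(* A number [m] with [m ^ 2 < 3 ^ k] has at most [4 k / 5] prime divisors,
   because [3 ^ 5 < 4 ^ 4]. *)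
Lemma size_le_prime_nondivisors (r : seq nat) (m : nat) : uniq r ->
    {in r, forall p, prime p} -> (0 < m)%N -> (m ^ 2 < 3 ^ size r)%N ->
  (size r <= 5 * count (fun p => ~~ (p %| m)) r)%N.
Proof.
move=> ur r_pr m0 mlt; set c := count _ _.
have cE : (count (fun p => p %| m)%N r + c = size r)%N by exact: count_predC.
have lt2 : (2 ^ count (fun p => p %| m)%N r <= m)%N.
  rewrite -size_filter; apply: expn2_size_prime_divisors => //.
    exact: filter_uniq.
  by move=> p; rewrite mem_filter => /andP[-> /r_pr ->].
rewrite leqNgt; apply/negP => c5.
suff : (3 ^ size r <= m ^ 2)%N by rewrite leqNgt mlt.
(* Let [k = size r] and let [d] count the divisors of [m] in [r]. Then [5 c < k] gives [4 k < 5 d],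
   so [3 ^ (5 k) <= 4 ^ (4 k) <= 4 ^ (5 d) = (2 ^ d) ^ 10 <= m ^ 10]. *)
rewrite -(@leq_exp2r _ _ 5) //; apply: (@leq_trans (4 ^ (4 * size r))).
  by rewrite -expnM mulnC !expnM leq_exp2r //; case: (size r) c5.
apply: (@leq_trans (4 ^ (5 * count (fun p => p %| m)%N r))).
  by rewrite leq_exp2l //; lia.
rewrite mulnC expnM leq_exp2r //.
by rewrite -(expnM 2 2) mulnC expnM leq_exp2r.
Qed.

Section LargeSieve.
Variables (R : realType) (s : nat) (P : {fset nat}).
Variables (chi : nat -> int -> R[i]) (w : int -> R).
Hypothesis s_ge2 : (2 <= s)%N.
Hypothesis P_pr : forall p : nat, p \in P -> prime p.
Hypothesis chi_dc : forall p : nat, p \in P -> dirichlet_character p (chi p).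
Hypothesis chi_pow : forall p : nat, p \in P ->
  forall n : int, chi p (n ^+ s) = @principal_character R p n.
Hypothesis w_ge0 : forall n : int, 0 <= w n.
Hypothesis w_supp : forall n : int, expR (#|` P|)%:R <= n%:~R :> R -> w n = 0.

Let A (n : int) : R[i] := \sum_(p <- P) chi p n.

(** Because [e < 3], the real cutoff of the support can be traded for an integer one, at which every
    sum may be truncated. *)
Lemma weight_finite_support (n : nat) : (3 ^ #|` P| <= n)%N -> w n = 0.
Proof.
move=> le3n; apply: w_supp; rewrite -[X in expR X]mulr1 expRM_natl.
rewrite -pmulrn; apply: (@le_trans _ _ (3 ^+ #|` P|)).
  by rewrite lerXn2r ?nnegrE ?expR_ge0 // ltW // expR1_lt3.
by rewrite -natrX ler_nat.
Qed.

Lemma character_sum_expn_ge (m : nat) : (0 < m)%N ->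
  w (m ^ s)%N != 0 -> (#|` P|%:R / 5) ^+ 2 <= `|A (m ^ s)%N| ^+ 2.
Proof.
move=> m0 wm; have -> : A (m ^ s)%N = (count (fun p => ~~ (p %| m)%N) P)%:R.
  rewrite -sum1_count natr_sum big_mkcond /= /A.
  rewrite big_seq [RHS]big_seq; apply: eq_bigr => p pP.
  rewrite -natz natrX natz (chi_pow pP) /principal_character.
  rewrite /coprimez /gcdz /= eqz_nat -/(coprime m p) coprime_sym.
  by rewrite prime_coprime ?P_pr //; case: dvdn.
rewrite normr_nat lerXn2r ?nnegrE ?divr_ge0 ?ler0n //.
rewrite ler_pdivrMr ?ltr0n // -natrM ler_nat mulnC.
apply: size_le_prime_nondivisors => //; first exact: fset_uniq.
(* As [s >= 2], a lower bound on [m ^ 2] is also one on [m ^ s], which would leave the support of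
   [w]. *)
rewrite ltnNge; apply: contra wm => le3; apply/eqP/weight_finite_support.
by rewrite (leq_trans le3) // leq_pexp2l.
Qed.

Lemma power_sum_le_second_moment (N : nat) : (3 ^ #|` P| <= N)%N ->
  (#|` P|%:R / 5) ^+ 2 * \sum_(1 <= m < N) (w (m ^ s)%N)%:C%C <=
    \sum_(1 <= n < N) (w n)%:C%C * `|A n| ^+ 2.
Proof.
move=> N3; rewrite mulr_sumr.
pose g (n : nat) := (w n)%:C%C * `|A n| ^+ 2.
apply: le_trans (ler_sum_expn (s := s) (g := g) _ _ _).
- rewrite big_nat [leRHS]big_nat; rewrite /g; apply: ler_sum => m /andP[m1 _].
  have [->|wm] := eqVneq (w (m ^ s)%N) 0; first by rewrite mulr0 mul0r.
  by rewrite mulrC ler_wpM2l ?lecR ?character_sum_expn_ge.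
- exact: leq_trans s_ge2.
- by move=> n; apply: mulr_ge0; rewrite ?exprn_ge0 // lecR.
- by move=> n Nn; rewrite /g weight_finite_support ?mul0r // (leq_trans N3).
Qed.

Lemma character_correlationE (N : nat) (f g : int -> R[i]) :
  (3 ^ #|` P| <= N)%N ->
  character_correlation w f g =
    \sum_(1 <= n < N.+1) (w n)%:C%C * f n * conjc (g n).
Proof.
move=> N3; apply: infinite_sum_finite => n Nn.
by rewrite weight_finite_support ?(leq_trans N3) // !mul0r.
Qed.

Lemma second_moment_le (N : nat) : (3 ^ #|` P| <= N)%N ->
  \sum_(1 <= n < N.+1) (w n)%:C%C * `|A n| ^+ 2 <=
    #|` P|%:R * \sum_(1 <= n < N.+1) (w n)%:C%C +
    \sum_(p <- P) \sum_(q <- P | p != q)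
       `|character_correlation w (chi p) (chi q)|.
Proof.
move=> N3; set S := leLHS.
(* Write [|A n| ^ 2] as [A n] times its conjugate, expand, and sum over [n] innermost. *)
have SE : S =
    \sum_(p <- P) \sum_(q <- P) character_correlation w (chi p) (chi q).
  under [RHS]eq_bigr => p _ do
    under eq_bigr => q _ do rewrite (character_correlationE _ _ N3).
  under [RHS]eq_bigr => p _ do rewrite exchange_big.
  rewrite exchange_big; apply: eq_bigr => n _.
  rewrite sqr_normc /A rmorph_sum /= mulr_suml mulr_sumr.
  apply: eq_bigr => p _; rewrite mulrA mulr_sumr.
  by apply: eq_bigr => q _.
have S_ge0 : 0 <= S.
  by apply: sumr_ge0 => n _; apply: mulr_ge0; rewrite ?exprn_ge0 // lecR.
(* The correlations are complex, so the triangle inequality is applied to [S] written as its own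
   norm. *)
rewrite -(ger0_norm S_ge0) SE.
rewrite -[#|` P|]/(size (enum_fset P)) -sum1_size natr_sum mulr_suml.
rewrite -big_split /= big_seq [leRHS]big_seq.
apply: (le_trans (ler_norm_sum _ _ _)); apply: ler_sum => p pP.
rewrite (bigD1_seq p) ?fset_uniq //=.
apply: (le_trans (ler_normD _ _)); apply: lerD; last first.
  under [leRHS]eq_bigl => q do rewrite eq_sym.
  exact: ler_norm_sum.
(* Diagonal term [q = p]: each summand is [w n * |chi p n| ^ 2 <= w n]. *)
rewrite mul1r (character_correlationE _ _ N3).
apply: (le_trans (ler_norm_sum _ _ _)); apply: ler_sum => n _.
have chi_le1 : `|chi p n| <= 1.
  apply: (dirichlet_character_norm_le1 (chi_dc pP) _ (chi_pow pP n)).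
  exact: ltnW.
have w_ge0C : 0 <= (w n)%:C%C by rewrite lecR.
rewrite !normrM normcJ (ger0_norm w_ge0C) -mulrA.
by rewrite ler_piMr // mulr_ile1.
Qed.

End LargeSieve.

Theorem theorem2 (R : realType) (s : nat) (hs : (2 <= s)%N) :
  exists C : R, 0 < C /\
    forall (P : {fset nat}) (chi : nat -> int -> R[i]) (w : int -> R),
      P <> fset0 ->
      (forall p : nat, p \in P -> prime p /\ gcdn s p.-1 <> 1%N) ->
      (forall p : nat, p \in P ->
         [/\ dirichlet_character p (chi p),
             chi p <> @principal_character R p
           & forall n : int, chi p (n ^+ s) = @principal_character R p n]) ->
      (forall n : int, 0 <= w n) ->
      summable [set: int] (fun n : int => (w n)%:E) ->
      w 0 = 0 ->
      (forall n : int, (expR (#|` P|)%:R : R) <= n%:~R -> w n = 0) ->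
      power_sifted_sum s w <=
        C * ((#|` P|)%:R^-1 * infinite_sum (fun n : nat => w n%:Z)
             + ((#|` P|)%:R ^+ 2)^-1 *
               \sum_(p <- P) \sum_(q <- P | p != q)
                 Normc.normc (character_correlation w (chi p) (chi q))).
Proof.
(* 25 is the inverse square of the proportion [1 / 5] of primes of [P] not dividing [m]. *)
exists 25; split; first by lra.
move=> P chi w P_neq0 hP hchi w_ge0 _ _ w_supp.
have P_pr p : p \in P -> prime p by case/hP.
have chi_dc p : p \in P -> dirichlet_character p (chi p) by case/hchi.
have chi_pow p : p \in P ->
    forall n, chi p (n ^+ s) = principal_character R p n.
  by case/hchi.
have P_gt0 : 0 < #|` P|%:R :> R.
  by rewrite ltr0n cardfs_gt0; apply/eqP.
set k := #|` P| in P_gt0 *; pose N := (3 ^ k)%N.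
have wN (n : nat) : (N <= n)%N -> w n = 0 by exact: weight_finite_support.
have -> : infinite_sum (fun n : nat => w n) = \sum_(1 <= n < N.+1) w n.
  exact: infinite_sum_finite.
have -> : power_sifted_sum s w = \sum_(1 <= m < N.+1) w (m ^ s)%N.
  under eq_bigr => m _ do rewrite -natz natrX natz.
  apply: infinite_sum_finite => m Nm; rewrite -natz -natrX natz wN //.
  rewrite (leq_trans Nm) // -[leqLHS]expn1 leq_pexp2l ?(ltnW hs) //.
  by rewrite (leq_trans _ Nm) ?expn_gt0.
set X := \sum_(1 <= m < _) _; set W := \sum_(1 <= n < _) _.
set D := \sum_(p <- _) _.
have XWD : (k%:R / 5) ^+ 2 * X <= k%:R * W + D.
  (* The moment bounds live in [R[i]], whose order extends that of [R]. *)
  rewrite -lecR.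
  rewrite !(rmorphD, rmorphM, rmorph_sum, rmorphXn, fmorphV, rmorph_nat) /=.
  have := power_sum_le_second_moment hs P_pr chi_pow w_ge0 w_supp (leqnSn N).
  move=> /le_trans; apply.
  have := second_moment_le hs chi_dc chi_pow w_ge0 w_supp (leqnn N).
  congr (_ <= _ + _); apply: eq_bigr => p _; rewrite rmorph_sum.
  exact: eq_bigr.
(* After this scaling the right-hand side is exactly [k * W + D]. *)
rewrite -(ler_pM2l (_ : 0 < (k%:R / 5) ^+ 2)) ?exprn_gt0 ?divr_gt0 //.
apply: (le_trans XWD); rewrite le_eqVlt; apply/orP; left; apply/eqP.
by field; rewrite gt_eqF.
Qed.
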